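(* In the Probabilistic Distance Clustering problem with $P$ centers on a network $\mathbf{G}=(\mathbf{E},\mathbf{V})$, a cluster center is always at a vertex of the network. That is, if $x_1,\dots,x_P\in\mathbf{G}$ are the cluster centers of an optimal solution of the problem, then each center $x_k$ is a vertex, i.e. belongs to $\mathbf{V}$ (and is never an interior point of an edge).
   Context: A network $\mathbf{G}=(\mathbf{E},\mathbf{V})$ is a finite, undirected, connected graph with vertex set $\mathbf{V}=\{v_1,\dots,v_N\}$ and edge set $\mathbf{E}$, in which each edge has a strictly positive length. Each edge is identified with a segment of its length, so that ''points of $\mathbf{G}$'' means vertices as well as interior points of edges, and $d(\cdot,\cdot)$ is the shortest path distance between points of $\mathbf{G}$. The Probabilistic Distance Clustering problem with $P$ clusters (centers) minimizes $\sum_{i=1}^N\sum_{k=1}^P p_{ik}^2\,d(v_i,x_k)$ over centers $x_1,\dots,x_P\in\mathbf{G}$ and memberships $p_{ik}\ge 0$ with $\sum_{k=1}^P p_{ik}=1$ for all $i=1,\dots,N$.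
   Formalization: The number P of centers is assumed to satisfy 2 ≤ P ≤ N, N the number of vertices; the claim fails otherwise: for P = 1 on a single edge every point is optimal, and for P > N ≥ 2 spare centers with zero membership may lie inside an edge. *)

(* Defs.v *)
From HB Require Import structures.
From mathcomp Require Import all_boot all_order all_algebra.
From mathcomp Require Import classical_sets reals.

Set Implicit Arguments.
Unset Strict Implicit.
Unset Printing Implicit Defensive.

Import Order.TTheory GRing.Theory Num.Theory.
Local Open Scope ring_scope.

(* Edges are abstract, so parallel edges and loops are allowed; a simple graph
   is a special case.  The order of the two ends of an edge carries no meaning:
   it only fixes from which end the coordinate along the edge is measured. *)
Record network (R : realType) := Network {
  vert : finType;
  edge : finType;
  end0 : edge -> vert;
  end1 : edge -> vert;
  len : edge -> R;
  len_gt0 : forall e, 0 < len e;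
  net_connected : forall u v : vert,
    connect (fun a b => [exists e, ((end0 e == a) && (end1 e == b))
                                || ((end0 e == b) && (end1 e == a))]) u v
}.

(* Coordinates of interior points are strictly between 0 and the length, so that
   each point of the network has exactly one representation. *)
Inductive net_point (R : realType) (G : network R) :=
| Vertex (v : vert G)
| Interior (e : edge G) (t : R) of 0 < t < len e.

(* [on_edge e t x]: x is the point of the closed edge e at distance t, measured
   along e, from end0 e.  If e is a loop, its vertex has both coordinates 0 and
   len e. *)
Definition on_edge (R : realType) (G : network R) (e : edge G) (t : R)
    (x : net_point G) : Prop :=
  match x with
  | Vertex v => (t = 0 /\ v = end0 e) \/ (t = len e /\ v = end1 e)
  | Interior e' t' _ => e' = e /\ t' = t
  end.

(* [path_length x y l]: some path from x to y, made of finitely many moves each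
   along a single closed edge, has total length l. *)
Inductive path_length (R : realType) (G : network R) :
    net_point G -> net_point G -> R -> Prop :=
| path_nil x : path_length x x 0
| path_cons (e : edge G) (s t : R) x y z l :
    on_edge e s x -> on_edge e t y -> path_length y z l ->
    path_length x z (`|s - t| + l).

Definition dist (R : realType) (G : network R) (x y : net_point G) : R :=
  inf [set l | path_length x y l]%classic.

Definition memberships (R : realType) (G : network R) (P : nat)
    (p : vert G -> 'I_P -> R) : Prop :=
  (forall i k, 0 <= p i k) /\ (forall i, \sum_(k < P) p i k = 1).

Definition pdc_cost (R : realType) (G : network R) (P : nat)
    (x : 'I_P -> net_point G) (p : vert G -> 'I_P -> R) : R :=
  \sum_(i : vert G) \sum_(k < P) p i k ^+ 2 * dist (Vertex i) (x k).

Definition pdc_optimal (R : realType) (G : network R) (P : nat)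
    (x : 'I_P -> net_point G) (p : vert G -> 'I_P -> R) : Prop :=
  memberships p /\
  forall (x' : 'I_P -> net_point G) (p' : vert G -> 'I_P -> R),
    memberships p' -> pdc_cost x p <= pdc_cost x' p'.

(* Main.v *)
(** Move the center x_k along an edge of length L with ends a and b: d(v, .) is
    concave there, so if an interior point c is optimal then, with the same
    memberships, a and b are optimal too.  For fixed centers, optimality of the
    memberships forces p_ik d(v_i, x_k) = p_ij d(v_i, x_j) for all j, k.  Fixing
    j <> k, this gives p_ik d(v_i, a) = p_ik d(v_i, c) = p_ik d(v_i, b).  But a
    shortest path from v_i to c passes through a or b, so d(v_i, c) exceeds one
    of d(v_i, a), d(v_i, b); hence p_ik = 0 for all i.  Then every product
    p_ij d(v_i, x_j) vanishes, so each of the N vertices carries one of the other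
    P - 1 < N centers, which is absurd. *)

Require Import Defs.
From mathcomp Require Import all_boot all_order all_algebra.
From mathcomp Require Import classical_sets reals.
From mathcomp Require Import lra.

Set Implicit Arguments.
Unset Strict Implicit.
Unset Printing Implicit Defensive.

Import Order.TTheory GRing.Theory Num.Theory.
Local Open Scope ring_scope.

(** * Shortest-path distance from a vertex to a point *)

Section Distance.
Variables (R : realType) (G : network R).
Implicit Types (x y z : net_point G) (e : edge G) (u v w : vert G).

Lemma path_length_ge0 x y l : path_length x y l -> 0 <= l.
Proof. by elim=> // e s t x' y' z l' _ _ _ l0; rewrite addr_ge0. Qed.

Lemma path_length_rcons x y z l e s t :
  path_length x y l -> on_edge e s y -> on_edge e t z ->
  path_length x z (l + `|s - t|).
Proof.
move=> xy; elim: xy z => [x' z sx tz|e' s' t' x' y' z' l' sx ty _ IH z sz tz].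
  by rewrite add0r -[`|s - t|]addr0; apply: path_cons sx tz (path_nil _).
by rewrite -addrA; apply: path_cons sx ty (IH _ sz tz).
Qed.

Lemma on_edge_end0 e : on_edge e 0 (Vertex (end0 e)).
Proof. by left. Qed.

Lemma on_edge_end1 e : on_edge e (len e) (Vertex (end1 e)).
Proof. by right. Qed.

Lemma path_length_vertices u v :
  exists l, path_length (Vertex u) (Vertex v) l.
Proof.
have /connectP[q] := net_connected u v.
elim: q u => [|w q IH] u /=; first by move=> _ ->; exists 0; apply: path_nil.
move=> /andP[/existsP[e /orP uw] /IH{}IH] /IH[l wv].
case: uw wv => /andP[/eqP <- /eqP <-] wv.
  by exists (`|0 - len e| + l);
    apply: path_cons (on_edge_end0 e) (on_edge_end1 e) wv.
by exists (`|len e - 0| + l);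
  apply: path_cons (on_edge_end1 e) (on_edge_end0 e) wv.
Qed.

Lemma path_length_exists u x : exists l, path_length (Vertex u) x l.
Proof.
case: x => [v|e t tP]; first exact: path_length_vertices.
have [l ul] := path_length_vertices u (end0 e).
by exists (l + `|0 - t|); apply: path_length_rcons ul (on_edge_end0 e) _.
Qed.

(** Connectivity enters here: some path exists, so [dist] is a true infimum and not the default
    value of [inf] on the empty set. *)
Lemma le_dist u x r :
  (forall l, path_length (Vertex u) x l -> r <= l) -> r <= dist (Vertex u) x.
Proof. by move=> rl; apply: lb_le_inf; [exact: path_length_exists|]. Qed.

Lemma dist_le_path u x l : path_length (Vertex u) x l -> dist (Vertex u) x <= l.
Proof.
by move=> ul; apply: ge_inf => //; exists 0 => l' /path_length_ge0.
Qed.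

Lemma dist_ge0 u x : 0 <= dist (Vertex u) x.
Proof. by apply: le_dist => l /path_length_ge0. Qed.

Lemma dist_refl u : dist (Vertex u) (Vertex u) = 0.
Proof. by apply/eqP; rewrite eq_le dist_ge0 dist_le_path //; apply: path_nil. Qed.

Lemma dist_on_edge u e s t x y :
  on_edge e s x -> on_edge e t y ->
  dist (Vertex u) y <= dist (Vertex u) x + `|s - t|.
Proof.
move=> sx ty; rewrite -lerBlDr; apply: le_dist => l ul.
by rewrite lerBlDr; apply/dist_le_path/(path_length_rcons ul sx ty).
Qed.

Lemma dist_ends u e :
  `|dist (Vertex u) (Vertex (end0 e)) - dist (Vertex u) (Vertex (end1 e))|
    <= len e.
Proof.
have L0 := len_gt0 e.
have := dist_on_edge u (on_edge_end0 e) (on_edge_end1 e).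
have := dist_on_edge u (on_edge_end1 e) (on_edge_end0 e).
by rewrite sub0r subr0 normrN gtr0_norm // ler_norml; lra.
Qed.

(* The largest 1-Lipschitz extension of [h] to the points of the network. *)
Definition lip_ext (h : vert G -> R) x : R :=
  match x with
  | Vertex v => h v
  | Interior e t _ => Num.min (h (end0 e) + t) (h (end1 e) + (len e - t))
  end.

Definition edge_lip (h : vert G -> R) :=
  forall e, `|h (end0 e) - h (end1 e)| <= len e.

(** At an end of an edge, [edge_lip] makes that end's own term the smaller one, so vertices (loops
    included) obey the interior formula. *)
Lemma lip_ext_on_edge h e t x : edge_lip h -> on_edge e t x ->
  lip_ext h x = Num.min (h (end0 e) + t) (h (end1 e) + (len e - t)).
Proof.
move=> hL; case: x => [v|e' t' tP] /=; last by case=> -> ->.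
have := hL e; rewrite ler_norml => /andP[h1 h2].
by case=> -[-> ->]; [rewrite min_l|rewrite min_r]; lra.
Qed.

Lemma lip_ext_path h x y l : edge_lip h -> path_length x y l ->
  lip_ext h y <= lip_ext h x + l.
Proof.
move=> hL; elim=> [x'|e s t x' y' z l' sx ty _ IH]; first by rewrite addr0.
apply: (le_trans IH); rewrite addrA lerD2r.
rewrite (lip_ext_on_edge hL sx) (lip_ext_on_edge hL ty).
have := ler_norm (s - t); have := ler_norm (t - s); rewrite [`|t - s|]distrC.
by move=> st ts; rewrite -lerBlDr le_min !lerBlDr !ge_min; apply/andP; split;
  apply/orP; [left|right]; lra.
Qed.

(** Duality: every potential [h] certifies a lower bound on distance, so no path has to be
    decomposed. *)
Lemma lip_ext_dist h u x : edge_lip h -> lip_ext h x - h u <= dist (Vertex u) x.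
Proof.
move=> hL; apply: le_dist => l ul.
by rewrite lerBlDl; apply: lip_ext_path hL ul.
Qed.

(** A path from a vertex enters the edge through one of its ends; obtained by taking distance from
    [u] as the potential. *)
Lemma dist_interior u e t (tP : 0 < t < len e) :
  Num.min (dist (Vertex u) (Vertex (end0 e)) + t)
          (dist (Vertex u) (Vertex (end1 e)) + (len e - t))
    <= dist (Vertex u) (Interior tP).
Proof.
have := @lip_ext_dist (fun w => dist (Vertex u) (Vertex w)) u (Interior tP).
by rewrite /= dist_refl subr0; apply; apply: dist_ends.
Qed.

Lemma dist_eq0 u x : dist (Vertex u) x = 0 -> x = Vertex u.
Proof.
(* The default 1 keeps [m] positive when there are no edges. The potential is 0 at [u] and [m] at
   all other vertices. *)
move=> d0; pose m : R := \big[Num.min/1]_(e : edge G) len e.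
have m0 : 0 < m by rewrite /m; elim/big_ind: _ => // [a b a0 b0|e _];
  [rewrite lt_min a0|exact: len_gt0].
have mL e : m <= len e by rewrite /m (bigD1 e) //= ge_min lexx.
pose h w : R := if w == u then 0 else m.
have hL : edge_lip h.
  by move=> e; have := mL e; rewrite /h ler_norml; case: ifP; case: ifP; lra.
have := lip_ext_dist u x hL; rewrite d0 /h eqxx subr0.
case: x {d0} => [v|e t tP] /=.
  by case: eqP => [-> //|_]; rewrite leNgt m0.
have /andP[t0 tL] := tP.
by rewrite leNgt lt_min => /negP[]; apply/andP; split; case: ifP => _; lra.
Qed.

(** Whichever end attains the minimum in [dist_interior], the distance to the other end is larger by
    at most [len e]. *)
Lemma dist_interior_concave u e t (tP : 0 < t < len e) :
  (len e - t) * dist (Vertex u) (Vertex (end0 e))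
    + t * dist (Vertex u) (Vertex (end1 e))
  <= len e * dist (Vertex u) (Interior tP).
Proof.
have := dist_interior u tP; have := dist_ends u e.
have /andP[t0 tL] := tP.
by rewrite ler_norml ge_min => /andP[? ?] /orP[?|?]; nra.
Qed.

End Distance.

(* Moving mass from [q] to [p] does not help only if the marginal cost of [q] is
   at most that of [p]. *)
Lemma marginal_cost_le (R : realType) (p q c d : R) :
  0 <= p -> 0 <= q -> 0 <= c -> 0 <= d ->
  (forall r, 0 <= r <= q ->
    p ^+ 2 * c + q ^+ 2 * d <= (p + r) ^+ 2 * c + (q - r) ^+ 2 * d) ->
  q * d <= p * c.
Proof.
move=> p0 q0 c0 d0 H; rewrite leNgt; apply/negP => lt_pq.
have pc0 : 0 <= p * c by rewrite mulr_ge0.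
have qc0 : 0 <= q * c by rewrite mulr_ge0.
have cd0 : 0 < c + d.
  rewrite lt_def addr_ge0 // andbT; apply/eqP => cd.
  by have dE : d = 0 by [lra]; move: lt_pq; rewrite dE mulr0; lra.
(* The minimizer of the quadratic in [r]; it lowers the cost by exactly [r ^+ 2 * (c + d)]. *)
pose r := (q * d - p * c) / (c + d).
have rE : r * (c + d) = q * d - p * c by rewrite divfK // gt_eqF.
have r0 : 0 < r by rewrite divr_gt0 // subr_gt0.
have rq : r <= q by rewrite ler_pdivrMr // mulrDr; lra.
have := H r; rewrite (ltW r0) rq => /(_ isT).
have rr0 : 0 < r * (r * (c + d)) by rewrite mulr_gt0 // mulr_gt0.
have rrE : r * (r * (c + d)) = r * (q * d - p * c) by rewrite rE.
by move: rr0 rrE; nra.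
Qed.

(** * Optimality conditions for memberships and centers *)

Section Optimality.
Variables (R : realType) (G : network R) (P : nat).
Implicit Types (x : 'I_P -> net_point G) (p : vert G -> 'I_P -> R).

Lemma optimal_marginal_le x p i (j k : 'I_P) :
  pdc_optimal x p ->
  p i j * dist (Vertex i) (x j) <= p i k * dist (Vertex i) (x k).
Proof.
case=> -[p0 p1] opt; have [<- //|jk] := eqVneq j k.
apply: marginal_cost_le; rewrite ?p0 ?dist_ge0 // => r /andP[r0 rj].
(* Transfer mass [r] from [j] to [k] at the single vertex [i]; all other terms of the cost
   cancel. *)
pose p' i' l := if i' == i then
  (if l == k then p i k + r else if l == j then p i j - r else p i l) else p i' l.
have p'k : p' i k = p i k + r by rewrite /p' !eqxx.
have p'j : p' i j = p i j - r by rewrite /p' !eqxx (negbTE jk).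
have p'l l : l != k -> l != j -> p' i l = p i l.
  by rewrite /p' eqxx => /negbTE -> /negbTE ->.
have p'i i' : i' != i -> p' i' =1 p i' by rewrite /p' => /negbTE ->.
have mem' : memberships p'.
  split=> [i' l|i'].
    rewrite /p'; case: ifP => // _; case: ifP => [_|_]; first by rewrite addr_ge0.
    by case: ifP => // _; rewrite subr_ge0.
  have [->|ne] := eqVneq i' i; last by rewrite (eq_bigr _ (fun l _ => p'i _ ne l)).
  rewrite -[RHS](p1 i) (bigD1 k) //= (bigD1 j) //= [RHS](bigD1 k) //=.
  rewrite [X in _ = _ + X](bigD1 j) //= p'k p'j.
  rewrite (eq_bigr (p i)) => [|l /andP[lk lj]]; [lra|exact: p'l].
have := opt x p' mem'; rewrite /pdc_cost (bigD1 i) //= [leRHS](bigD1 i) //=.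
rewrite [X in _ <= _ + X](eq_bigr
    (fun i' => \sum_(l < P) p i' l ^+ 2 * dist (Vertex i') (x l))); last first.
  by move=> i' ne; apply: eq_bigr => l _; rewrite p'i.
rewrite lerD2r (bigD1 k) //= (bigD1 j) //= [leRHS](bigD1 k) //=.
rewrite [X in _ <= _ + X](bigD1 j) //= p'k p'j.
rewrite [X in _ <= _ + (_ + X)](eq_bigr
    (fun l => p i l ^+ 2 * dist (Vertex i) (x l))); last first.
  by move=> l /andP[lk lj]; rewrite p'l.
lra.
Qed.

Lemma optimal_marginal_eq x p i (j k : 'I_P) :
  pdc_optimal x p ->
  p i j * dist (Vertex i) (x j) = p i k * dist (Vertex i) (x k).
Proof. by move=> opt; apply/le_anti; rewrite !optimal_marginal_le. Qed.

Definition move_center x (k : 'I_P) (y : net_point G) : 'I_P -> net_point G :=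
  fun l => if l == k then y else x l.

Definition center_cost p (k : 'I_P) (y : net_point G) : R :=
  \sum_i p i k ^+ 2 * dist (Vertex i) y.

Lemma pdc_cost_move x p k y :
  pdc_cost (move_center x k y) p
    = pdc_cost x p + (center_cost p k y - center_cost p k (x k)).
Proof.
rewrite /pdc_cost /center_cost -sumrB -big_split /=; apply: eq_bigr => i _.
rewrite (bigD1 k) //= [X in _ = X + _](bigD1 k) //= /move_center eqxx.
rewrite (eq_bigr (fun l => p i l ^+ 2 * dist (Vertex i) (x l))); first lra.
by move=> l /negbTE ->.
Qed.

Lemma optimal_center_cost_le x p k y :
  pdc_optimal x p -> center_cost p k (x k) <= center_cost p k y.
Proof.
by case=> mem /(_ (move_center x k y) p mem); rewrite pdc_cost_move lerDl subr_ge0.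
Qed.

Lemma optimal_move x p k y :
  pdc_optimal x p -> center_cost p k y = center_cost p k (x k) ->
  pdc_optimal (move_center x k y) p.
Proof. by case=> mem opt yE; split=> //; rewrite pdc_cost_move yE subrr addr0. Qed.

(** Neither end costs less than [x k], yet by concavity a mean of the two with strictly positive
    weights costs no more; both are equalities. *)
Lemma optimal_interior_ends x p k e t (tP : 0 < t < len e) :
  pdc_optimal x p -> x k = Interior tP ->
  pdc_optimal (move_center x k (Vertex (end0 e))) p /\
  pdc_optimal (move_center x k (Vertex (end1 e))) p.
Proof.
move=> opt xk.
have le0 := optimal_center_cost_le k (Vertex (end0 e)) opt.
have le1 := optimal_center_cost_le k (Vertex (end1 e)) opt.
have conc : (len e - t) * center_cost p k (Vertex (end0 e))
    + t * center_cost p k (Vertex (end1 e)) <= len e * center_cost p k (x k).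
  rewrite /center_cost !mulr_sumr -big_split /=; apply: ler_sum => i _.
  rewrite !(mulrCA _ (p i k ^+ 2)) -mulrDr xk.
  by apply: ler_wpM2l; [rewrite sqr_ge0|exact: dist_interior_concave].
have /andP[t0 tL] := tP.
by split; apply: optimal_move => //; apply/le_anti; rewrite ?le0 ?le1 andbT; nra.
Qed.

End Optimality.

Theorem theorem4p4 (R : realType) (G : network R) (P : nat)
    (hP : (1 < P <= #|vert G|)%N)
    (x : 'I_P -> net_point G) (p : vert G -> 'I_P -> R)
    (hopt : pdc_optimal x p) :
  forall k : 'I_P, exists v : vert G, x k = Vertex v.
Proof.
move=> k; case xk : (x k) => [v|e t tP]; first by exists v.
exfalso; have /andP[P1 PN] := hP.
have [opt0 opt1] := optimal_interior_ends hopt xk.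
have [j jk] : exists j : 'I_P, j != k.
  have: (0 < #|predC1 k|)%N by rewrite cardC1 card_ord -subn1 subn_gt0.
  by case/card_gt0P=> j; exists j.
have pk0 i : p i k = 0.
  (* Center [j] stays put in all three optimal solutions, so its product is the common value. *)
  have ec := optimal_marginal_eq i j k hopt; rewrite xk in ec.
  have ea := optimal_marginal_eq i j k opt0.
  have eb := optimal_marginal_eq i j k opt1.
  rewrite /move_center eqxx (negbTE jk) in ea eb.
  apply/eqP; apply: contraT => /mulfI inj.
  have ac := inj _ _ (etrans (esym ea) ec).
  have bc := inj _ _ (etrans (esym eb) ec).
  have := dist_interior i tP; rewrite ac bc; have /andP[t0 tL] := tP.
  by rewrite ge_min => /orP[]; lra.
have cover i : exists l : 'I_P, (l != k) /\ x l = Vertex i.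
  have [mem sum1] := hopt.1.
  have [l pl] : exists l, p i l != 0.
    apply/existsP; apply: contraT => /existsPn all0; have := sum1 i.
    rewrite big1 => [/eqP|l _]; first by rewrite eq_sym oner_eq0.
    by apply/eqP; have := all0 l; rewrite negbK.
  exists l; split; first by apply: contraNneq pl => ->; rewrite pk0.
  apply: dist_eq0; apply/eqP; have := optimal_marginal_eq i l k hopt.
  by rewrite pk0 mul0r => /eqP; rewrite mulf_eq0 (negbTE pl).
have [f fP] := boolp.choice cover.
(* A center sits at only one vertex, so the vertices inject into the [P.-1] indices other than
   [k]. *)
have f_inj : injective f.
  move=> u v uv; have [_ xu] := fP u; have [_ xv] := fP v.
  by rewrite uv xv in xu; case: xu.
have : (#|vert G| <= #|predC1 k|)%N.
  rewrite -(card_codom f_inj); apply: subset_leq_card; apply/fintype.subsetP => l.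
  by case/codomP=> v ->; rewrite inE; have [] := fP v.
by rewrite cardC1 card_ord => /(leq_trans PN); rewrite -ltnS prednK ?ltnn // ltnW.
Qed.
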